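(* For every nonnegative integer $n$ and every integer $p$ with $0\leq p\leq n$: $$\sum_{k=p+1}^n \frac{1}{k-p}H_k = \frac{1}{2} \left[ (H_{n-p+1}+H_p)^2 + H_{n-p+1}^{(2)} + H_p^{(2)} \right] - H_{n+1} \left( H_p + \frac{1}{n-p+1} \right) + \sum_{k=0}^{p-1} \frac{1}{n-p+k+2} H_k .$$
   Context: For a nonnegative integer $n$ and a positive integer $m$, the generalized harmonic number is $H_n^{(m)} = \sum_{k=1}^n \frac{1}{k^m}$, so that $H_0^{(m)}=0$. The traditional harmonic number is $H_n = H_n^{(1)}$. Powers such as $(\cdot)^2$ denote ordinary squares, while the parenthesized superscript in $H_n^{(2)}$ denotes the order. Empty sums (upper limit less than lower limit) are zero. *)

(* Defs.v *)
From mathcomp Require Import all_boot all_order all_algebra.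

Set Implicit Arguments.
Unset Strict Implicit.
Unset Printing Implicit Defensive.

Import Order.TTheory GRing.Theory Num.Theory.
Local Open Scope ring_scope.

Definition gen_harmonic (m n : nat) : rat :=
  \sum_(1 <= k < n.+1) 1 / k%:R ^+ m.

Definition harmonic (n : nat) : rat := gen_harmonic 1 n.

(* Main.v *)
Require Import Defs.
From mathcomp Require Import all_boot all_order all_algebra.
From mathcomp Require Import ring.

(** Put m = n - p, so that the left-hand side is the sum of H_(j + p) / j over
    1 <= j <= m, and induct on p with m fixed. When p grows by one, each H_(j + p)
    gains 1 / (j + p + 1), so the left-hand side gains the sum of
    1 / (j (j + p + 1)), which partial fractions evaluate to
    (H_m - H_(m + p + 1) + H_(p + 1)) / (p + 1)  [sum_partial_fraction]. The
    right-hand side gains the same amount: the increment H_p / (m + p + 2) of its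
    last sum cancels against the H_p part of the product with H_(n + 1), and what
    that product leaves over simplifies because
    1 / (p + 1) + 1 / (m + 1) = (m + p + 2) / ((p + 1) (m + 1)).
    At p = 0 the identity expresses that the sum of H_j / j is half of
    H_m^2 + H_m^(2), the symmetric sum of 1 / (i j) with its diagonal
    [sum_harmonic_div]. *)

Set Implicit Arguments.
Unset Strict Implicit.
Unset Printing Implicit Defensive.

Import Order.TTheory GRing.Theory Num.Theory.
Local Open Scope ring_scope.

Lemma gen_harmonic0 m : gen_harmonic m 0 = 0.
Proof. by rewrite /gen_harmonic big_geq. Qed.

Lemma gen_harmonicS m n :
  gen_harmonic m n.+1 = gen_harmonic m n + 1 / n.+1%:R ^+ m.
Proof. by rewrite /gen_harmonic big_nat_recr. Qed.

Lemma harmonic0 : harmonic 0 = 0.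
Proof. exact: gen_harmonic0. Qed.

Lemma harmonicS n : harmonic n.+1 = harmonic n + 1 / n.+1%:R.
Proof. by rewrite /harmonic gen_harmonicS expr1. Qed.

Lemma ratS_neq0 n : n.+1%:R != 0 :> rat.
Proof. by rewrite pnatr_eq0. Qed.

(** Both sides count the pairs i <= j with weight 1 / (i j): in the double sum
    H_m^2, the terms with i <= j and those with i >= j have equal totals and
    overlap in the diagonal H_m^(2). *)
Lemma sum_harmonic_div m :
  \sum_(1 <= j < m.+1) 1 / j%:R * harmonic j
  = 1 / 2 * (harmonic m ^+ 2 + gen_harmonic 2 m).
Proof.
elim: m => [|m IHm].
  by rewrite big_geq // harmonic0 gen_harmonic0; ring.
rewrite big_nat_recr //= IHm harmonicS gen_harmonicS.
by move: (m.+1%:R : rat) (ratS_neq0 m) => a ha; field.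
Qed.

(** The telescoping of (1 / j - 1 / (j + p + 1)) / (p + 1). *)
Lemma sum_partial_fraction m p :
  \sum_(1 <= j < m.+1) 1 / j%:R * (1 / (j + p).+1%:R)
  = 1 / p.+1%:R * (harmonic m - harmonic (m + p).+1 + harmonic p.+1) :> rat.
Proof.
elim: m => [|m IHm].
  by rewrite big_geq // harmonic0 add0n; ring.
rewrite big_nat_recr //= IHm addSn (harmonicS m) (harmonicS (m + p).+1).
have -> : (m + p).+2%:R = m.+1%:R + p.+1%:R :> rat by rewrite -natrD addSn addnS.
have nz : m.+1%:R + p.+1%:R != 0 :> rat by rewrite -natrD addSn ratS_neq0.
move: (ratS_neq0 m) (ratS_neq0 p) nz.
move: (m.+1%:R : rat) (p.+1%:R : rat) => a b ha hb hab.
by field; rewrite ha hb hab.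
Qed.

(** Taking m rather than n = m + p as the parameter keeps the range of the
    left-hand sum and the weights on both sides fixed while p varies, which is
    what makes the induction on p compare the sums term by term. *)
Lemma sum_harmonic_shift_div m p :
  \sum_(1 <= j < m.+1) 1 / j%:R * harmonic (j + p)
  = 1 / 2 * ((harmonic m.+1 + harmonic p) ^+ 2
             + gen_harmonic 2 m.+1 + gen_harmonic 2 p)
    - harmonic (m + p).+1 * (harmonic p + 1 / m.+1%:R)
    + \sum_(0 <= k < p) 1 / (m + k + 2)%:R * harmonic k.
Proof.
elim: p => [|p IHp].
  rewrite [X in _ = _ + X]big_geq // harmonic0 gen_harmonic0 addn0.
  under eq_bigr do rewrite addn0.
  rewrite sum_harmonic_div harmonicS gen_harmonicS.
  by move: (m.+1%:R : rat) (ratS_neq0 m) => a ha; field.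
under eq_bigr do rewrite addnS harmonicS mulrDr.
rewrite big_split /= IHp sum_partial_fraction.
rewrite [X in _ = _ + X]big_nat_recr //= addnS (harmonicS (m + p).+1).
rewrite (harmonicS m) (harmonicS p) !gen_harmonicS addn2.
(* With a = m + 1 and b = p + 1, all remaining denominators are a, b and a + b,
   and 1 / a + 1 / b = (a + b) / (a b) closes the rational identity. *)
have -> : (m + p).+2%:R = m.+1%:R + p.+1%:R :> rat by rewrite -natrD addSn addnS.
have nz : m.+1%:R + p.+1%:R != 0 :> rat by rewrite -natrD addSn ratS_neq0.
move: (ratS_neq0 m) (ratS_neq0 p) nz.
move: (m.+1%:R : rat) (p.+1%:R : rat) => a b ha hb hab.
by field; rewrite ha hb hab.
Qed.

Theorem theorem2p3 (n p : nat) (hp : (p <= n)%N) :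
  \sum_(p.+1 <= k < n.+1) 1 / (k - p)%:R * harmonic k
  = 1 / 2 * ((harmonic (n - p + 1) + harmonic p) ^+ 2
             + gen_harmonic 2 (n - p + 1) + gen_harmonic 2 p)
    - harmonic (n + 1) * (harmonic p + 1 / (n - p + 1)%:R)
    + \sum_(0 <= k < p) 1 / (n - p + k + 2)%:R * harmonic k.
Proof.
have := sum_harmonic_shift_div (n - p) p.
rewrite subnK // !addn1 => <-.
rewrite -[p.+1]add1n big_addn subSn //.
by apply: eq_bigr => j _; rewrite addnK.
Qed.
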